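(* Let $R,S$ be rings and let $M$ be an $(R,S)$-bimodule. Then $S$ is $M$-semiseparable over $R$ if and only if there is a central idempotent $z\in S$ (necessarily unique) such that $M$ is obtained by restriction of scalars from an $(R,Sz)$-bimodule $N$, via $\varphi:S\to Sz$, $s\mapsto sz$, and $Sz$ is $N$-separable over $R$. Furthermore, in this case, $S$ is $M$-separable over $R$ if and only if $z=1_S$.
   Context: Rings are unital and associative. For a central idempotent $z\in S$, $Sz$ is a ring with the addition and multiplication of $S$ and identity $z$, and $\varphi:S\to Sz$, $s\mapsto sz$, is a ring homomorphism. For an $(R,S)$-bimodule $M$, $M^*=\mathrm{Hom}_S(M,S)$ (right $S$-linear maps) is an $(S,R)$-bimodule via $(sfr)(m)=sf(rm)$. For an $S$-bimodule $X$, $X^S=\{x\in X\mid sx=xs\ \forall s\in S\}$. $S$ is $M$-separable over $R$ if the evaluation map $\mathrm{ev}_M:M^*\otimes_RM\to S$, $f\otimes_Rm\mapsto f(m)$, is a split epimorphism of $S$-bimodules, i.e. there is $\sum_if_i\otimes_Rm_i\in(M^*\otimes_RM)^S$ with $\sum_if_i(m_i)=1_S$ (and similarly for the ring $Sz$ and the $(R,Sz)$-bimodule $N$). $S$ is $M$-semiseparable over $R$ if there is $\sum_if_i\otimes_Rm_i\in(M^*\otimes_RM)^S$ such that $\sum_imf_i(m_i)=m$ for every $m\in M$. *)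

(* Defs.v *)
From HB Require Import structures.
From mathcomp Require Import all_boot all_algebra.
From mathcomp Require Import boolp functions.
From mathcomp Require Import freeg.

Set Implicit Arguments.
Unset Strict Implicit.
Unset Printing Implicit Defensive.
Import GRing.Theory.
Local Open Scope ring_scope.
Local Open Scope quotient_scope.

(* The zero ring is allowed (pzRingType): Sz below is zero when z = 0.
   (R,S)-bimodule: the left action is MathComp's lmodType structure. *)
HB.mixin Record Lmodule_isBimodule (R S : pzRingType) M of GRing.Lmodule R M := {
  rscale : M -> S -> M;
  rscaleDl : forall m1 m2 s, rscale (m1 + m2) s = rscale m1 s + rscale m2 s;
  rscaleDr : forall m s1 s2, rscale m (s1 + s2) = rscale m s1 + rscale m s2;
  rscaleA : forall m s1 s2, rscale (rscale m s1) s2 = rscale m (s1 * s2);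
  rscale1 : forall m, rscale m 1 = m;
  scale_rscaleA : forall (r : R) m s, rscale (r *: m) s = r *: rscale m s
}.

#[short(type="bimodType")]
HB.structure Definition Bimodule (R S : pzRingType) :=
  {M of GRing.Lmodule R M & Lmodule_isBimodule R S M}.

Notation "m :* s" := (rscale m s) : ring_scope.

Section BimoduleTheory.
Variables (R S : pzRingType).

Definition bimod_hom (M N : bimodType R S) (f : M -> N) : Prop :=
  linear f /\ forall m s, f (m :* s) = f m :* s.

Definition bimod_iso (M N : bimodType R S) : Prop :=
  exists f : M -> N, bimod_hom f /\ bijective f.

Definition split_epi (M N : bimodType R S) (f : M -> N) : Prop :=
  exists g : N -> M, bimod_hom g /\ cancel g f.

End BimoduleTheory.

(* x \in X^S *)
Definition invariant (S : pzRingType) (X : bimodType S S) (x : X) : Prop :=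
  forall s : S, s *: x = x :* s.

(* S as an S-bimodule; the left structure is MathComp's S^o. *)
Section Regular.
Variable S : pzRingType.
Definition regular_rscale (x : S^o) (s : S) : S^o := (x : S) * s.

Fact regular_rscaleDl x y s :
  regular_rscale (x + y) s = regular_rscale x s + regular_rscale y s.
Proof. exact: mulrDl. Qed.
Fact regular_rscaleDr x s t :
  regular_rscale x (s + t) = regular_rscale x s + regular_rscale x t.
Proof. exact: mulrDr. Qed.
Fact regular_rscaleA x s t :
  regular_rscale (regular_rscale x s) t = regular_rscale x (s * t).
Proof. by rewrite /regular_rscale mulrA. Qed.
Fact regular_rscale1 x : regular_rscale x 1 = x.
Proof. exact: mulr1. Qed.
Fact regular_scale_rscaleA (r : S) x s :
  regular_rscale (r *: x) s = r *: regular_rscale x s.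
Proof. by rewrite /regular_rscale /GRing.scale /= mulrA. Qed.

HB.instance Definition _ := Lmodule_isBimodule.Build S S S^o
  regular_rscaleDl regular_rscaleDr regular_rscaleA regular_rscale1
  regular_scale_rscaleA.
End Regular.

Section Dual.
Variables (R S : pzRingType) (M : bimodType R S).

Definition rlinear (f : M -> S) : Prop :=
  (forall x y, f (x + y) = f x + f y) /\ forall x s, f (x :* s) = f x * s.

Definition rlinear_pred : {pred M -> S} := fun f => `[< rlinear f >].

Fact rlinear_zmod_closed : zmod_closed rlinear_pred.
Proof.
split.
  by apply/asboolP; split=> *; [exact: esym (addr0 0) | exact: esym (mul0r _)].
move=> f g /asboolP[fD fZ] /asboolP[gD gZ]; apply/asboolP; split=> x y.
  change (f (x + y) - g (x + y) = f x - g x + (f y - g y)).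
  by rewrite fD gD opprD addrACA.
change (f (x :* y) - g (x :* y) = (f x - g x) * y).
by rewrite fZ gZ mulrBl.
Qed.
HB.instance Definition _ :=
  GRing.isZmodClosed.Build (M -> S) rlinear_pred rlinear_zmod_closed.

(* M^* = Hom_S(M, S), with (s f r)(m) = s f(r m) below. *)
Record rdual := RDual { rdual_val :> M -> S; _ : rdual_val \in rlinear_pred }.
HB.instance Definition _ := [isSub for rdual_val].
HB.instance Definition _ := [Choice of rdual by <:].
HB.instance Definition _ := [SubChoice_isSubZmodule of rdual by <:].

Lemma rdualP (f : rdual) : rlinear f.
Proof. by case: f => f /= /asboolP. Qed.

Lemma rdual_ext (f g : rdual) : f =1 g -> f = g.
Proof. by move=> fg; apply: val_inj; apply: funext. Qed.

Lemma rdualD (f g : rdual) x : (f + g) x = f x + g x.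
Proof. by []. Qed.

Fact rdual_scale_subproof (s : S) (f : rdual) :
  (fun m => s * f m) \in rlinear_pred.
Proof.
have [fD fZ] := rdualP f; apply/asboolP; split=> x y; first by rewrite fD mulrDr.
by rewrite fZ mulrA.
Qed.
Definition rdual_scale s f := RDual (rdual_scale_subproof s f).

Fact rdual_scaleA s t f : rdual_scale s (rdual_scale t f) = rdual_scale (s * t) f.
Proof. by apply: rdual_ext => m /=; rewrite mulrA. Qed.
Fact rdual_scale1 : left_id 1 rdual_scale.
Proof. by move=> f; apply: rdual_ext => m /=; rewrite mul1r. Qed.
Fact rdual_scaleDr : right_distributive rdual_scale +%R.
Proof. by move=> s f g; apply: rdual_ext => m; rewrite /= mulrDr. Qed.
Fact rdual_scaleDl f : {morph rdual_scale^~ f : s t / s + t}.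
Proof. by move=> s t; apply: rdual_ext => m; rewrite /= mulrDl. Qed.
HB.instance Definition _ := GRing.Zmodule_isLmodule.Build S rdual
  rdual_scaleA rdual_scale1 rdual_scaleDr rdual_scaleDl.

Fact rdual_rscale_subproof (f : rdual) (r : R) :
  (fun m => f (r *: m)) \in rlinear_pred.
Proof.
have [fD fZ] := rdualP f; apply/asboolP; split=> x y.
  by rewrite scalerDr fD.
by rewrite -scale_rscaleA fZ.
Qed.
Definition rdual_rscale f r := RDual (rdual_rscale_subproof f r).

Fact rdual_rscaleDl f g r :
  rdual_rscale (f + g) r = rdual_rscale f r + rdual_rscale g r.
Proof. exact: rdual_ext. Qed.
Fact rdual_rscaleDr f r t :
  rdual_rscale f (r + t) = rdual_rscale f r + rdual_rscale f t.
Proof.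
by apply: rdual_ext => m; rewrite /= scalerDl; case: (rdualP f) => ->.
Qed.
Fact rdual_rscaleA f r t : rdual_rscale (rdual_rscale f r) t = rdual_rscale f (r * t).
Proof. by apply: rdual_ext => m; rewrite /= scalerA. Qed.
Fact rdual_rscale1 f : rdual_rscale f 1 = f.
Proof. by apply: rdual_ext => m; rewrite /= scale1r. Qed.
Fact rdual_scale_rscaleA (s : S) f r :
  rdual_rscale (s *: f) r = s *: rdual_rscale f r.
Proof. exact: rdual_ext. Qed.
HB.instance Definition _ := Lmodule_isBimodule.Build S R rdual
  rdual_rscaleDl rdual_rscaleDr rdual_rscaleA rdual_rscale1 rdual_scale_rscaleA.

End Dual.

Section Tensor.
Variables (P Q T : pzRingType) (A : bimodType P Q) (B : bimodType Q T).

Inductive tens_rel : {freeg (A * B)} -> Prop :=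
| TensRelDl a1 a2 b : tens_rel (<<(a1 + a2, b)>> - (<<(a1, b)>> + <<(a2, b)>>))
| TensRelDr a b1 b2 : tens_rel (<<(a, b1 + b2)>> - (<<(a, b1)>> + <<(a, b2)>>))
| TensRelM a q b : tens_rel (<<(a :* q, b)>> - <<(a, q *: b)>>).

(* The subgroup generated by the relators. *)
Definition tens_ker : {pred {freeg (A * B)}} := fun x =>
  `[< forall H : {pred {freeg (A * B)}},
        zmod_closed H -> (forall u, tens_rel u -> u \in H) -> x \in H >].

Fact tens_ker_zmod_closed : zmod_closed tens_ker.
Proof.
split; first by apply/asboolP => H [].
move=> x y /asboolP xH /asboolP yH; apply/asboolP => H HC HR.
by case: (HC) => _; apply; [apply: xH | apply: yH].
Qed.
HB.instance Definition _ :=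
  GRing.isZmodClosed.Build {freeg (A * B)} tens_ker tens_ker_zmod_closed.

(* A \otimes_Q B *)
Definition tens : Type := Quotient.quot tens_ker.
HB.instance Definition _ := GRing.Zmodule.on tens.

Definition pure (a : A) (b : B) : tens := \pi_(Quotient.quot tens_ker) <<(a, b)>>.

Definition balanced (V : zmodType) (f : A -> B -> V) : Prop :=
  [/\ forall a1 a2 b, f (a1 + a2) b = f a1 b + f a2 b,
      forall a b1 b2, f a (b1 + b2) = f a b1 + f a b2
    & forall a q b, f (a :* q) b = f a (q *: b)].

Let tens_pi (x : {freeg (A * B)}) : tens := \pi_(Quotient.quot tens_ker) x.

Lemma tens_piD x y : tens_pi (x + y) = tens_pi x + tens_pi y.
Proof. exact: Quotient.pi_add. Qed.

Lemma tens_piN x : tens_pi (- x) = - tens_pi x.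
Proof. exact: Quotient.pi_opp. Qed.

Lemma tens_piB x y : tens_pi (x - y) = tens_pi x - tens_pi y.
Proof. by rewrite tens_piD tens_piN. Qed.

Lemma tens_pi0 : tens_pi 0 = 0.
Proof. by rewrite -[X in tens_pi X](subrr 0) tens_piB subrr. Qed.

Lemma tens_pi_eq x y : tens_ker (x - y) -> tens_pi x = tens_pi y.
Proof. by move=> kxy; apply/eqP; rewrite -Quotient.idealrBE. Qed.

Lemma tens_ker_rel x : tens_rel x -> tens_ker x.
Proof. by move=> rx; apply/asboolP => H _; apply. Qed.

Lemma pure_balanced : balanced pure.
Proof.
split=> [a1 a2 b|a b1 b2|a q b].
- by rewrite /pure -tens_piD; apply/tens_pi_eq/tens_ker_rel; constructor.
- by rewrite /pure -tens_piD; apply/tens_pi_eq/tens_ker_rel; constructor.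
- by apply/tens_pi_eq/tens_ker_rel; constructor.
Qed.

(* The additive map induced by f; meaningful only when f is balanced. *)
Definition tens_lift (V : zmodType) (f : A -> B -> V) (t : tens) : V :=
  fglift (fun ab => f ab.1 ab.2 : zmodule V) (repr t).

Section Lift.
Variables (V : zmodType) (f : A -> B -> V).
Hypothesis fB : balanced f.
Let g : {freeg (A * B)} -> zmodule V := fglift (fun ab => f ab.1 ab.2 : zmodule V).

Let gB : {morph g : x y / x - y}. Proof. exact: lift_is_additive. Qed.
Let g0 : g 0 = 0. Proof. by rewrite -(subrr 0) gB subrr. Qed.
Let gN : {morph g : x / - x}.
Proof. by move=> x; rewrite -[- x]sub0r gB g0 sub0r. Qed.
Let gD : {morph g : x y / x + y}.
Proof. by move=> x y; rewrite -[y in LHS]opprK gB gN opprK. Qed.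
Let gU ab : g <<ab>> = f ab.1 ab.2.
Proof. by rewrite /g liftU scale1r. Qed.

Let g_ker x : tens_ker x -> g x = 0.
Proof.
case: fB => fDl fDr fM /asboolP xK.
apply/eqP; apply: (xK (fun y => g y == 0)) => [|u].
  split=> [|u v]; rewrite /in_mem /= ?g0 // => /eqP gu /eqP gv.
  by rewrite gB gu gv subrr.
by case=> *; rewrite /in_mem /= gB ?gD !gU /= ?fDl ?fDr ?fM subrr.
Qed.

Let lift_pi x : tens_lift f (tens_pi x) = g x.
Proof.
apply/eqP; rewrite -subr_eq0 -[_ - _]gB; apply/eqP/g_ker.
have : (repr (tens_pi x) - x) \in tens_ker.
  by rewrite Quotient.idealrBE; apply/eqP/reprK.
by [].
Qed.

Lemma tens_lift_zmod_morphism : zmod_morphism (tens_lift f).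
Proof.
move=> s t; rewrite -[s]reprK -[t]reprK -/(tens_pi _) -/(tens_pi _).
by rewrite -tens_piB !lift_pi gB.
Qed.

Lemma tens_lift_pure a b : tens_lift f (pure a b) = f a b.
Proof. by rewrite [LHS]lift_pi gU. Qed.

Lemma tens_lift0 : tens_lift f 0 = 0.
Proof.
by rewrite -[X in tens_lift f X](subrr 0) tens_lift_zmod_morphism subrr.
Qed.

Lemma tens_liftD s t : tens_lift f (s + t) = tens_lift f s + tens_lift f t.
Proof.
rewrite -[t in LHS]opprK tens_lift_zmod_morphism; congr (_ + _).
by rewrite -[- t]sub0r tens_lift_zmod_morphism tens_lift0 sub0r opprK.
Qed.

Lemma tens_lift_sum n (a : 'I_n -> A) (b : 'I_n -> B) :
  tens_lift f (\sum_i pure (a i) (b i)) = \sum_i f (a i) (b i).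
Proof.
elim/big_rec2: _ => [|i x y _ <-]; first exact: tens_lift0.
by rewrite tens_liftD tens_lift_pure.
Qed.

End Lift.

Lemma tens_sub_ind (D : tens -> Prop) :
  D 0 -> (forall s t, D s -> D t -> D (s - t)) -> (forall a b, D (pure a b)) ->
  forall t, D t.
Proof.
move=> D0 DB DU t; rewrite -[t]reprK -/(tens_pi _).
have DN s : D s -> D (- s) by move=> Ds; rewrite -sub0r; apply: DB.
have DD s u : D s -> D u -> D (s + u).
  by move=> Ds Du; rewrite -[u]opprK; apply: DB => //; apply: DN.
set x : {freeg (A * B)} := repr t; rewrite -(freeg_sumE x).
elim: (dom x) => [|ab r IHr]; first by rewrite big_nil tens_pi0.
rewrite big_cons tens_piD; apply: (DD) => {IHr}//.
have Dn n : D (tens_pi << n%:Z *g ab >>).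
  elim: n => [|n IHn]; first by rewrite freegU0 tens_pi0.
  rewrite -addn1 PoszD -freegUD tens_piD; apply: DD => //.
  by case: ab {IHn} => a b; apply: DU.
by case: (coeff ab x) => n; rewrite ?NegzE -?freegUN ?tens_piN; [|apply: DN].
Qed.

Lemma tens_decomp (t : tens) : exists n (a : 'I_n -> A) (b : 'I_n -> B),
  t = \sum_i pure (a i) (b i).
Proof.
have [pDl _ _] := pure_balanced.
have pNl a b : - pure a b = pure (- a) b.
  apply/eqP; rewrite -subr_eq0 -opprD oppr_eq0 -pDl subrr; apply/eqP.
  by apply: (addrI (pure 0 b)); rewrite -pDl !addr0.
have {pNl pDl}: exists s : seq (A * B), t = \sum_(p <- s) pure p.1 p.2.
  elim/tens_sub_ind: t => [|_ _ [s ->] [u ->]|a b].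
  - by exists [::]; rewrite big_nil.
  - exists (s ++ [seq (- p.1, p.2) | p <- u]); rewrite big_cat big_map -sumrN.
    by congr (_ + _); apply: eq_bigr => p _; rewrite pNl.
  - by exists [:: (a, b)]; rewrite big_seq1.
case=> s ->; exists (size s).
exists (fun i => (tnth (in_tuple s) i).1), (fun i => (tnth (in_tuple s) i).2).
by rewrite big_tnth.
Qed.

Lemma tens_ext (V : zmodType) (f g : tens -> V) :
  zmod_morphism f -> zmod_morphism g ->
  (forall a b, f (pure a b) = g (pure a b)) -> f =1 g.
Proof.
move=> fB gB fg; apply: tens_sub_ind => // [|s t fgs fgt].
  by rewrite -[X in f X](subrr 0) -[X in g X](subrr 0) fB gB !subrr.
by rewrite fB gB fgs fgt.
Qed.

Definition tens_scale (p : P) : tens -> tens :=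
  tens_lift (fun a b => pure (p *: a) b).
Definition tens_rscale (t : tens) (u : T) : tens :=
  tens_lift (fun a b => pure a (b :* u)) t.

Lemma tens_scale_balanced (p : P) : balanced (fun a b => pure (p *: a) b).
Proof.
have [pDl pDr pM] := pure_balanced; split=> *; first by rewrite scalerDr pDl.
- by rewrite pDr.
- by rewrite -scale_rscaleA pM.
Qed.

Lemma tens_rscale_balanced (u : T) : balanced (fun a b => pure a (b :* u)).
Proof.
have [pDl pDr pM] := pure_balanced; split=> *; first by rewrite pDl.
- by rewrite rscaleDl pDr.
- by rewrite pM scale_rscaleA.
Qed.

Lemma tens_scale_pure p a b : tens_scale p (pure a b) = pure (p *: a) b.
Proof. exact: (tens_lift_pure (tens_scale_balanced p)). Qed.
Lemma tens_rscale_pure u a b : tens_rscale (pure a b) u = pure a (b :* u).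
Proof. exact: (tens_lift_pure (tens_rscale_balanced u)). Qed.

Let scaleB p : zmod_morphism (tens_scale p).
Proof. exact: (tens_lift_zmod_morphism (tens_scale_balanced p)). Qed.
Let rscaleB u : zmod_morphism (tens_rscale^~ u).
Proof. exact: (tens_lift_zmod_morphism (tens_rscale_balanced u)). Qed.

Fact tens_scaleA p q t : tens_scale p (tens_scale q t) = tens_scale (p * q) t.
Proof.
move: t; apply: tens_ext => [s t|s t|a b]; rewrite ?scaleB //.
by rewrite !tens_scale_pure scalerA.
Qed.
Fact tens_scale1 : left_id 1 tens_scale.
Proof.
by apply: tens_ext => [s t|s t|a b]; rewrite ?scaleB // tens_scale_pure scale1r.
Qed.
Fact tens_scaleDr : right_distributive tens_scale +%R.
Proof. by move=> p s t; apply: (tens_liftD (tens_scale_balanced p)). Qed.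
Fact tens_scaleDl t : {morph tens_scale^~ t : p q / p + q}.
Proof.
move=> p q; move: t; apply: tens_ext => [s t|s t|a b].
- exact: scaleB.
- by rewrite /= !scaleB opprD addrACA.
- by rewrite !tens_scale_pure scalerDl; case: pure_balanced => ->.
Qed.
HB.instance Definition _ := GRing.Zmodule_isLmodule.Build P tens
  tens_scaleA tens_scale1 tens_scaleDr tens_scaleDl.

Fact tens_rscaleDl s t u :
  tens_rscale (s + t) u = tens_rscale s u + tens_rscale t u.
Proof. exact: (tens_liftD (tens_rscale_balanced u)). Qed.
Fact tens_rscaleDr t u v :
  tens_rscale t (u + v) = tens_rscale t u + tens_rscale t v.
Proof.
move: t; apply: tens_ext => [s t|s t|a b].
- exact: rscaleB.
- by rewrite /= !rscaleB opprD addrACA.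
- by rewrite !tens_rscale_pure rscaleDr; case: pure_balanced => _ ->.
Qed.
Fact tens_rscaleA t u v : tens_rscale (tens_rscale t u) v = tens_rscale t (u * v).
Proof.
move: t; apply: tens_ext => [s t|s t|a b]; rewrite ?rscaleB //.
by rewrite !tens_rscale_pure rscaleA.
Qed.
Fact tens_rscale1 t : tens_rscale t 1 = t.
Proof.
move: t; apply: tens_ext => [s t|s t|a b]; rewrite ?rscaleB //.
by rewrite tens_rscale_pure rscale1.
Qed.
Fact tens_scale_rscaleA (p : P) t u :
  tens_rscale (p *: t) u = p *: tens_rscale t u.
Proof.
rewrite /GRing.scale /=.
move: t; apply: tens_ext => [s t|s t|a b]; rewrite ?scaleB ?rscaleB ?scaleB //.
by rewrite !(tens_scale_pure, tens_rscale_pure).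
Qed.
HB.instance Definition _ := Lmodule_isBimodule.Build P T tens
  tens_rscaleDl tens_rscaleDr tens_rscaleA tens_rscale1 tens_scale_rscaleA.

End Tensor.

Section Separability.
Variables (R S : pzRingType) (M : bimodType R S).

Definition ev : tens (rdual M) M -> S^o := 
  tens_lift (fun (f : rdual M) (m : M) => f m : S^o).

Lemma ev_balanced : balanced (fun (f : rdual M) (m : M) => f m : S^o).
Proof. by split=> // f x y; case: (rdualP f) => ->. Qed.

Lemma ev_pure (f : rdual M) m : ev (pure f m) = f m.
Proof. exact: (tens_lift_pure ev_balanced). Qed.

Lemma ev_bimod_hom : bimod_hom ev.
Proof.
have evB : zmod_morphism ev := tens_lift_zmod_morphism ev_balanced.
have evZ s t : ev (s *: t) = s *: ev t.
  move: t; apply: tens_ext => [x y|x y|f m].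
  - by rewrite scalerBr evB.
  - by rewrite evB scalerBr.
  - by rewrite [s *: _]tens_scale_pure !ev_pure.
split=> [s x y|t s].
  by rewrite -evZ; apply: (tens_liftD ev_balanced).
move: t; apply: tens_ext => [x y|x y|f m].
- rewrite [(x - y) :* s](tens_lift_zmod_morphism (tens_rscale_balanced _ _ s)).
  exact: evB.
- by rewrite evB; apply: mulrBl.
- rewrite [_ :* s]tens_rscale_pure !ev_pure; by case: (rdualP f) => _ ->.
Qed.

Definition separable : Prop := split_epi ev.

Lemma separableP : separable <->
  exists n (f : 'I_n -> rdual M) (m : 'I_n -> M),
    invariant (\sum_i pure (f i) (m i)) /\ \sum_i f i (m i) = 1.
Proof.
have [evL evR] := ev_bimod_hom.
split=> [[g [[gL gR] gK]]|[n [f [m [inv fm1]]]]].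
  have [n [f [m fm]]] := tens_decomp (g 1).
  exists n, f, m; rewrite -fm; split=> [s|].
    have g0 : g 0 = 0.
      by have := gL (-1) 0 0; rewrite scaler0 addr0 scaleN1r addNr.
    have := gL s 1 0; rewrite g0 !addr0 => <-.
    by rewrite -gR; congr g; apply: etrans (mulr1 s) (esym (mul1r s)).
  by rewrite -[RHS]gK fm; apply/esym/(tens_lift_sum ev_balanced).
exists (fun s => s *: \sum_i pure (f i) (m i)); split; first split.
- by move=> s x y; rewrite scalerDl scalerA.
- by move=> x s; rewrite [x :* s]/(x * s : S) -scalerA inv scale_rscaleA.
- move=> s; have := evL s (\sum_i pure (f i) (m i)) 0.
  rewrite [ev 0](tens_lift0 ev_balanced) !addr0 => ->.
  by rewrite [ev _](tens_lift_sum ev_balanced) [X in _ *: X]fm1; apply: mulr1.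
Qed.

Definition semiseparable : Prop :=
  exists n (f : 'I_n -> rdual M) (m : 'I_n -> M),
    invariant (\sum_i pure (f i) (m i)) /\
    forall x : M, \sum_i x :* f i (m i) = x.

End Separability.

(* phi^* N: the additive group N with m.s := m.phi(s). *)
Definition restr (R S T : pzRingType) (phi : {rmorphism S -> T})
  (N : bimodType R T) : Type := N.

Section Restriction.
Variables (R S T : pzRingType) (phi : {rmorphism S -> T}) (N : bimodType R T).

HB.instance Definition _ := GRing.Lmodule.copy (restr phi N) N.

Definition restr_rscale (m : restr phi N) (s : S) : restr phi N :=
  (m : N) :* phi s.

Fact restr_rscaleDl m1 m2 s :
  restr_rscale (m1 + m2) s = restr_rscale m1 s + restr_rscale m2 s.
Proof. exact: rscaleDl. Qed.
Fact restr_rscaleDr m s t :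
  restr_rscale m (s + t) = restr_rscale m s + restr_rscale m t.
Proof. by rewrite /restr_rscale rmorphD; apply: rscaleDr. Qed.
Fact restr_rscaleA m s t :
  restr_rscale (restr_rscale m s) t = restr_rscale m (s * t).
Proof. by rewrite /restr_rscale rmorphM; apply: rscaleA. Qed.
Fact restr_rscale1 m : restr_rscale m 1 = m.
Proof. by rewrite /restr_rscale rmorph1; apply: rscale1. Qed.
Fact restr_scale_rscaleA (r : R) m s :
  restr_rscale (r *: m) s = r *: restr_rscale m s.
Proof. exact: scale_rscaleA. Qed.
HB.instance Definition _ := Lmodule_isBimodule.Build R S (restr phi N)
  restr_rscaleDl restr_rscaleDr restr_rscaleA restr_rscale1 restr_scale_rscaleA.

End Restriction.

Definition central_idempotent (S : pzRingType) (z : S) : Prop :=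
  z * z = z /\ forall s, s * z = z * s.

Section Corner.
Variables (S : pzRingType) (z : S) (hz : central_idempotent z).

Definition corner_pred (y : S) : {pred S} := fun x => `[< exists s, x = s * y >].

Fact corner_zmod_closed y : zmod_closed (corner_pred y).
Proof.
split; first by apply/asboolP; exists 0; rewrite mul0r.
move=> _ _ /asboolP[s ->] /asboolP[t ->]; apply/asboolP; exists (s - t).
by rewrite mulrBl.
Qed.
HB.instance Definition _ y :=
  GRing.isZmodClosed.Build S (corner_pred y) (corner_zmod_closed y).

(* The ring Sz, with unit z. *)
Record corner (h : central_idempotent z) :=
  Corner { corner_val : S; _ : corner_val \in corner_pred z }.

Local Notation Sz := (corner hz).

HB.instance Definition _ := [isSub of Sz for @corner_val hz].
HB.instance Definition _ := [Choice of Sz by <:].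
HB.instance Definition _ := [SubChoice_isSubZmodule of Sz by <:].

Lemma corner_valP (x : Sz) : exists s, corner_val x = s * z.
Proof. by case: x => x /= /asboolP. Qed.

Lemma corner_mulz (x : Sz) : corner_val x * z = corner_val x.
Proof.
by have [s ->] := corner_valP x; rewrite -mulrA (proj1 hz).
Qed.

Fact corner_mul_subproof (x y : Sz) :
  corner_val x * corner_val y \in corner_pred z.
Proof. by apply/asboolP; exists (corner_val x * corner_val y); rewrite -mulrA corner_mulz. Qed.
Definition corner_mul (x y : Sz) : Sz := Corner hz (corner_mul_subproof x y).

Fact corner_proj_subproof (s : S) : s * z \in corner_pred z.
Proof. by apply/asboolP; exists s. Qed.

Definition corner_proj (s : S) : Sz := Corner hz (corner_proj_subproof s).

Fact corner_one_subproof : z \in corner_pred z.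
Proof. by apply/asboolP; exists 1; rewrite mul1r. Qed.
Definition corner_one : Sz := Corner hz corner_one_subproof.

Fact corner_mulA : associative corner_mul.
Proof. by move=> x y t; apply: val_inj; apply: mulrA. Qed.
Fact corner_mul1r : left_id corner_one corner_mul.
Proof.
move=> x; apply: val_inj; rewrite /= -[RHS]corner_mulz.
by rewrite (proj2 hz).
Qed.
Fact corner_mulr1 : right_id corner_one corner_mul.
Proof. by move=> x; apply: val_inj; apply: corner_mulz. Qed.
Fact corner_mulDl : left_distributive corner_mul +%R.
Proof. by move=> x y t; apply: val_inj; apply: mulrDl. Qed.
Fact corner_mulDr : right_distributive corner_mul +%R.
Proof. by move=> x y t; apply: val_inj; apply: mulrDr. Qed.
HB.instance Definition _ := GRing.Zmodule_isPzRing.Build Sz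
  corner_mulA corner_mul1r corner_mulr1 corner_mulDl corner_mulDr.

Fact corner_proj_zmod_morphism : zmod_morphism corner_proj.
Proof. by move=> s t; apply: val_inj; apply: mulrBl. Qed.
Fact corner_proj_monoid_morphism : monoid_morphism corner_proj.
Proof.
split=> [|s t]; apply: val_inj; first exact: mul1r.
have [zz zC] := hz.
by rewrite /= -!mulrA (zC t) (mulrA z z) zz.
Qed.
HB.instance Definition _ :=
  GRing.isZmodMorphism.Build S Sz corner_proj corner_proj_zmod_morphism.
HB.instance Definition _ :=
  GRing.isMonoidMorphism.Build S Sz corner_proj corner_proj_monoid_morphism.

End Corner.

(* "M is obtained by restriction of scalars from N" is read up to isomorphism
   of (R,S)-bimodules. *)
Definition separable_corner (R S : pzRingType) (M : bimodType R S) (z : S) : Prop :=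
  exists (hz : central_idempotent z) (N : bimodType R (corner hz)),
    bimod_iso M (restr (corner_proj hz) N) /\ separable N.

(* Main.v *)
Require Import Defs.
From HB Require Import structures.
From mathcomp Require Import all_boot all_algebra.
From mathcomp Require Import boolp.

(* If t = sum_i f_i (x) m_i witnesses semiseparability, then z := ev_M t acts as
   the identity on M, so z z = sum_i f_i(m_i z) = z; thus M is an (R, Sz)-bimodule
   and t also witnesses its separability over Sz.  Conversely a witness of
   separability over Sz is an invariant t with ev_M t = z, where z acts as the
   identity on M.  For any two z, z' that act as the identity and belong to the
   image of ev_M, z z' = z; this gives uniqueness and the case z' = 1. *)

Set Implicit Arguments.
Unset Strict Implicit.
Unset Printing Implicit Defensive.
Import GRing.Theory.

Local Open Scope ring_scope.

Lemma rscale_sumr (R S : pzRingType) (M : bimodType R S) (x : M)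
    n (s : 'I_n -> S) :
  \sum_i x :* s i = x :* (\sum_i s i).
Proof.
elim/big_rec2: _ => [|i a y _ ->]; last by rewrite rscaleDr.
by apply: (addrI (x :* 0)); rewrite -rscaleDr !addr0.
Qed.

Section TensorMap.
Variables (R S T : pzRingType).
Variables (A : bimodType S R) (B : bimodType R S).
Variables (A' : bimodType T R) (B' : bimodType R T).
Variables (alpha : A -> A') (beta : B -> B') (phi : T -> S).
Hypothesis alphaD : {morph alpha : x y / x + y}.
Hypothesis betaD : {morph beta : x y / x + y}.
Hypothesis alpha_rscale : forall a (r : R), alpha (a :* r) = alpha a :* r.
Hypothesis beta_scale : forall (r : R) b, beta (r *: b) = r *: beta b.
Hypothesis alpha_scale : forall t a, alpha (phi t *: a) = t *: alpha a.
Hypothesis beta_rscale : forall b t, beta (b :* phi t) = beta b :* t.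

(** The additive map induced by [alpha] and [beta] on the tensor products is semilinear along [phi]
    on both sides, hence carries invariants to invariants. [phi] is a bare function because it
    serves both for the projection of S onto Sz and for the inclusion of Sz in S, which need not
    preserve 1. *)
Lemma invariant_map n (a : 'I_n -> A) (b : 'I_n -> B) :
  Defs.invariant (\sum_i pure (a i) (b i)) ->
  Defs.invariant (\sum_i pure (alpha (a i)) (beta (b i))).
Proof.
move=> inv t; have [pDl pDr pM] := pure_balanced A' B'.
have bal : balanced (fun x y => pure (alpha x) (beta y)).
  split=> *; first by rewrite alphaD pDl.
  - by rewrite betaD pDr.
  - by rewrite alpha_rscale beta_scale pM.
pose h := tens_lift (fun x y => pure (alpha x) (beta y)).
have hB : zmod_morphism h := tens_lift_zmod_morphism bal.
have h_scale : forall x, h (phi t *: x) = t *: h x.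
  apply: tens_ext => [x y|x y|x y].
  - by rewrite scalerBr hB.
  - by rewrite hB scalerBr.
  - by rewrite [_ *: pure _ _]tens_scale_pure /h !tens_lift_pure // alpha_scale
               [RHS]tens_scale_pure.
have h_rscale : forall x, h (x :* phi t) = h x :* t.
  apply: tens_ext => [x y|x y|x y].
  - rewrite [(x - y) :* _](tens_lift_zmod_morphism (tens_rscale_balanced _ _ _)).
    exact: hB.
  - rewrite hB.
    exact: (tens_lift_zmod_morphism (tens_rscale_balanced _ _ _)).
  - by rewrite [pure _ _ :* _]tens_rscale_pure /h !tens_lift_pure // beta_rscale
               [RHS]tens_rscale_pure.
by rewrite -(tens_lift_sum bal) -h_scale inv h_rscale.
Qed.

End TensorMap.

Section CornerModule.
Variables (R S : pzRingType) (M : bimodType R S) (z : S).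
Variable hz : central_idempotent z.
Hypothesis Mz : forall x : M, x :* z = x.

(** An alias of M indexed by the proof that z fixes M: that proof is the unit axiom of the Sz-action
    attached to the alias. *)
Definition corner_module (_ : forall x : M, x :* z = x) : Type := M.
Local Notation N := (corner_module Mz).

HB.instance Definition _ := GRing.Lmodule.copy N M.

Definition corner_rscale (x : N) (s : corner hz) : N :=
  (x : M) :* corner_val s.

Fact corner_rscaleDl x y s :
  corner_rscale (x + y) s = corner_rscale x s + corner_rscale y s.
Proof. exact: rscaleDl. Qed.
Fact corner_rscaleDr x s t :
  corner_rscale x (s + t) = corner_rscale x s + corner_rscale x t.
Proof. exact: rscaleDr. Qed.
Fact corner_rscaleA x s t :
  corner_rscale (corner_rscale x s) t = corner_rscale x (s * t).
Proof. exact: rscaleA. Qed.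
Fact corner_rscale1 x : corner_rscale x 1 = x.
Proof. exact: Mz. Qed.
Fact corner_scale_rscaleA (r : R) x s :
  corner_rscale (r *: x) s = r *: corner_rscale x s.
Proof. exact: scale_rscaleA. Qed.
HB.instance Definition _ := Lmodule_isBimodule.Build R (corner hz) N
  corner_rscaleDl corner_rscaleDr corner_rscaleA corner_rscale1
  corner_scale_rscaleA.

Lemma corner_module_restr : bimod_iso M (restr (corner_proj hz) N).
Proof.
exists id; split; last by exists id.
(* Since z fixes M, x s = (x s) z = x (s z), which is the restricted action. *)
by split=> // x s; rewrite -[X in X = _]Mz rscaleA.
Qed.

(** As f x = f (x z) = (f x) z, the values of f already lie in Sz, and [corner_proj] only changes
    their type. *)
Lemma rdual_corner_subproof (f : rdual M) :
  (fun x : N => corner_proj hz (f x)) \in @rlinear_pred R _ N.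
Proof.
have [fD fZ] := rdualP f; apply/asboolP; split=> x y; first by rewrite fD rmorphD.
rewrite [x :* y]/(_ :* corner_val y) fZ rmorphM; congr (_ * _).
by apply: val_inj; apply: corner_mulz.
Qed.
Definition rdual_corner f : rdual N := RDual (rdual_corner_subproof f).

Lemma corner_module_separable n (f : 'I_n -> rdual M) (m : 'I_n -> M) :
  Defs.invariant (\sum_i pure (f i) (m i)) -> \sum_i f i (m i) = z ->
  separable N.
Proof.
move=> inv fmz; apply/separableP; exists n, (rdual_corner \o f), m.
split; last first.
  rewrite -(raddf_sum (corner_proj hz)) fmz.
  by apply: val_inj; apply: (proj1 hz).
apply: (invariant_map (phi := @corner_val _ _ hz) (beta := id : M -> N)) inv
  => // [f1 f2|f1 r|s f1]; apply: rdual_ext => x //=.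
- exact: (rmorphD (corner_proj hz)).
- by apply: val_inj; rewrite /= mulrA.
Qed.

End CornerModule.

Section RestrictionDual.
Variables (R S : pzRingType) (z : S) (hz : central_idempotent z).
Variables (M : bimodType R S) (N : bimodType R (corner hz)).
Variable h : M -> restr (corner_proj hz) N.
Hypothesis h_hom : bimod_hom h.

Lemma rdual_restr_subproof (g : rdual N) :
  (fun x => corner_val (g (h x))) \in @rlinear_pred R S M.
Proof.
have [hL hZ] := h_hom; have [gD gZ] := rdualP g.
apply/asboolP; split=> x y.
  by rewrite -[x]scale1r hL !scale1r gD.
(* Centrality turns y z into z y, and the value of g, lying in Sz, absorbs z. *)
by rewrite hZ [_ :* y]/(_ :* corner_proj hz y : N) gZ /= (proj2 hz) mulrA corner_mulz.
Qed.
Definition rdual_restr g : rdual M := RDual (rdual_restr_subproof g).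

End RestrictionDual.

(** The common form of both notions: [separable M] is the case z = 1, while [semiseparable M] asks
    for such a z that fixes M. *)
Definition invariant_value (R S : pzRingType) (M : bimodType R S) (z : S) :=
  exists n (f : 'I_n -> rdual M) (m : 'I_n -> M),
    Defs.invariant (\sum_i pure (f i) (m i)) /\ \sum_i f i (m i) = z.

(** Each term satisfies f_i(m_i) w = f_i(m_i w) = f_i(m_i). Taking w = z gives idempotence. *)
Lemma invariant_valueM (R S : pzRingType) (M : bimodType R S) (z w : S) :
  invariant_value M z -> (forall x : M, x :* w = x) -> z * w = z.
Proof.
move=> [n [f [m [_ <-]]]] Mw; rewrite mulr_suml; apply: eq_bigr => i _.
by have [_ <-] := rdualP (f i); rewrite Mw.
Qed.

(** The bimodule map [ev] sends invariants to invariants of S, that is, to central elements. *)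
Lemma invariant_value_central (R S : pzRingType) (M : bimodType R S) (z s : S) :
  invariant_value M z -> s * z = z * s.
Proof.
move=> [n [f [m [inv fmz]]]]; have [evL evR] := ev_bimod_hom M.
have evz : ev (\sum_i pure (f i) (m i)) = z.
  by rewrite -fmz; apply: (tens_lift_sum (ev_balanced M)).
have := evL s (\sum_i pure (f i) (m i)) 0.
rewrite [ev 0](tens_lift0 (ev_balanced M)) !addr0 inv evR evz.
exact: esym.
Qed.

(** This eliminates N and the isomorphism, leaving conditions on M and z alone. *)
Lemma separable_cornerP (R S : pzRingType) (M : bimodType R S) (z : S) :
  separable_corner M z <->
  invariant_value M z /\ forall x : M, x :* z = x.
Proof.
split=> [[hz [N [[h [h_hom [k hK kK]]] /separableP[n [g [m [inv gm1]]]]]]]|].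
  have [hL hZ] := h_hom.
  have hrD x y : h (x + y) = h x + h y by rewrite -[x]scale1r hL !scale1r.
  have h0 : h 0 = 0 by apply: (addIr (h 0)); rewrite -hrD !add0r.
  have hrZ r x : h (r *: x) = r *: h x by rewrite -[_ *: x]addr0 hL h0 addr0.
  split; last first.
    (* On N, z acts through [corner_proj], whose value at z is z z = z, the unit of Sz. *)
    move=> x; apply: (can_inj hK); rewrite hZ -[RHS](@rscale1 R _ N).
    congr (@rscale R _ N _ _).
    by apply: val_inj; apply: (proj1 hz).
  (* Functionals on N are pulled back along h, and elements of N are sent to M by its inverse k. *)
  exists n, (fun i => rdual_restr h_hom (g i)), (k \o m); split; last first.
    rewrite /= -[RHS]/(corner_val (1 : corner hz)) -gm1.
    rewrite (big_morph (@corner_val _ _ hz) (fun _ _ => erefl) erefl).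
    apply: eq_bigr => i _.
    by rewrite /= kK.
  apply: (invariant_map (phi := corner_proj hz) (alpha := rdual_restr h_hom)) inv
    => [g1 g2|x y|g1 r|r x|s g1|x s]; try exact: rdual_ext.
  (* Additivity and both linearities of k are checked after applying the injective map h. *)
  - by apply: (can_inj hK); rewrite hrD !kK.
  - by apply: rdual_ext => x /=; rewrite hrZ.
  - by apply: (can_inj hK); rewrite hrZ !kK.
  - by apply: rdual_ext => x /=; rewrite -mulrA -(proj2 hz) corner_mulz.
  - by apply: (can_inj hK); rewrite hZ !kK.
case=> Mz_val Mz; have hz : central_idempotent z.
  split=> [|s]; first exact: invariant_valueM Mz_val Mz.
  exact: invariant_value_central Mz_val.
exists hz, (corner_module Mz); split; first exact: corner_module_restr.
by have [n [f [m [inv fmz]]]] := Mz_val; apply: corner_module_separable inv fmz.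
Qed.

Lemma semiseparableP (R S : pzRingType) (M : bimodType R S) :
  semiseparable M <->
  exists z, invariant_value M z /\ forall x : M, x :* z = x.
Proof.
split=> [[n [f [m [inv fm]]]]|[z [[n [f [m [inv fmz]]]] Mz]]].
  exists (\sum_i f i (m i)); split; first by exists n, f, m.
  by move=> x; rewrite -rscale_sumr.
by exists n, f, m; split=> // x; rewrite rscale_sumr fmz.
Qed.

Theorem proposition3p22 (R S : pzRingType) (M : bimodType R S) :
  [/\ semiseparable M <-> exists z : S, separable_corner M z,
      forall z1 z2 : S, separable_corner M z1 -> separable_corner M z2 -> z1 = z2
    & forall z : S, separable_corner M z -> (separable M <-> z = 1)].
Proof.
split.
- split=> [/semiseparableP[z ?]|[z /separable_cornerP ?]].
    by exists z; apply/separable_cornerP.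
  by apply/semiseparableP; exists z.
- move=> z1 z2 /separable_cornerP[v1 Mz1] /separable_cornerP[v2 Mz2].
  (* z1 = z1 z2 and z2 = z2 z1, so commutation of z1 with z2 suffices. *)
  rewrite -(invariant_valueM v1 Mz2) -[RHS](invariant_valueM v2 Mz1).
  exact: invariant_value_central v2.
- move=> z /separable_cornerP[vz Mz]; split=> [/separableP v1|z1].
    (* Here 1 is an invariant value and z fixes M, whence 1 z = 1. *)
    by rewrite -[RHS](invariant_valueM v1 Mz) mul1r.
  by apply/separableP; rewrite -z1.
Qed.
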